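(* Let $N\ge 1$ and let $f:[0,1]\to\mathbb{R}$ be continuous and strictly increasing. Then $(\Delta_N,D_f)$, where $D_f(P,Q)=\max_i\big(f(q_i)-f(p_i)\big)$, is a unitopological quasimetric space, and its topology (the common forward and backward topology) is the standard Euclidean topology on $\Delta_N$.
   Context: $\Delta_N=\{P=(p_0,\dots,p_N)\in[0,1]^{N+1} : \sum_i p_i=1\}$ is the $N$-dimensional probability simplex in $\mathbb{R}^{N+1}$. For a continuous strictly increasing $f:[0,1]\to\mathbb{R}$ one sets $D_f(P,Q)=\max_{0\le i\le N}\big(f(q_i)-f(p_i)\big)$ for $P,Q\in\Delta_N$. (Without loss of generality $f$ may be rescaled affinely so that $f(0)=0$, $f(1)=1$; this only multiplies $D_f$ by a positive constant.) A quasimetric on a set $X$ is a map $D:X\times X\to\mathbb{R}$ such that for all $x,y,z\in X$: $D(x,y)\ge 0$; $D(x,y)=0$ if and only if $x=y$; $D(x,z)\le D(x,y)+D(y,z)$. No symmetry is assumed. The pair $(X,D)$ is a quasimetric space. The forward balls $\{y\in X : D(x,y)<r\}$ form a base of the forward topology, and the backward balls $\{y\in X : D(y,x)<r\}$ form a base of the backward topology. $(X,D)$ is called unitopological if the forward and backward topologies coincide; equivalently, for all $x\in X$ and all sequences $(x_n)$ in $X$, $D(x,x_n)\to 0$ if and only if $D(x_n,x)\to 0$. *)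

(* Defs.v *)
From mathcomp Require Import all_boot all_order all_algebra.
From mathcomp Require Import all_classical all_reals all_analysis.

Set Implicit Arguments.
Unset Strict Implicit.
Unset Printing Implicit Defensive.

Import Order.TTheory GRing.Theory Num.Theory.
Import numFieldNormedType.Exports.

Local Open Scope classical_set_scope.
Local Open Scope ring_scope.

Record is_quasimetric (R : realType) (X : Type) (D : X -> X -> R) : Prop := {
  quasimetric_ge0 : forall x y, 0 <= D x y ;
  quasimetric_eq0 : forall x y, D x y = 0 <-> x = y ;
  quasimetric_triangle : forall x y z, D x z <= D x y + D y z }.

Definition forward_ball (R : realType) (X : Type) (D : X -> X -> R)
  (x : X) (r : R) : set X := [set y | D x y < r].

Definition backward_ball (R : realType) (X : Type) (D : X -> X -> R)
  (x : X) (r : R) : set X := [set y | D y x < r].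

(* The open sets of the topology having the family B as a base. *)
Definition open_of_base (X : Type) (B : set (set X)) : set (set X) :=
  [set U | exists2 C : set (set X), C `<=` B & U = \bigcup_(V in C) V].

Definition forward_open (R : realType) (X : Type) (D : X -> X -> R) :
    set (set X) :=
  open_of_base
    [set V | exists x, exists2 r, 0 < r & V = forward_ball D x r].

Definition backward_open (R : realType) (X : Type) (D : X -> X -> R) :
    set (set X) :=
  open_of_base
    [set V | exists x, exists2 r, 0 < r & V = backward_ball D x r].

Definition unitopological (R : realType) (X : Type) (D : X -> X -> R) : Prop :=
  forward_open D = backward_open D.

(* As a type, [prob_simplex R N] is the [set_type] of this set, which carries
   the topology induced by that of 'rV[R]_N.+1. The latter is built from the
   max norm, so it is the Euclidean topology. *)
Definition prob_simplex (R : realType) (N : nat) : set 'rV[R]_N.+1 :=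
  [set p | (forall i, 0 <= p 0 i <= 1) /\ \sum_i p 0 i = 1].
Arguments prob_simplex : clear implicits.

(* The default value of the \big operator is the term of index 0, so that this
   is exactly the maximum of the N.+1 differences, whatever their signs.
   Only the values of f on [0, 1] matter. *)
Definition simplex_dist (R : realType) (N : nat) (f : R -> R)
    (P Q : prob_simplex R N) : R :=
  let p := \val P in let q := \val Q in
  \big[Num.max/f (q 0 ord0) - f (p 0 ord0)]_(i < N.+1)
    (f (q 0 i) - f (p 0 i)).

(* Main.v *)
Require Import Defs.
From mathcomp Require Import all_boot all_order all_algebra.
From mathcomp Require Import all_classical all_reals all_analysis.
From mathcomp Require Import lra.

Import Order.TTheory GRing.Theory Num.Theory.
Import numFieldNormedType.Exports.

Local Open Scope classical_set_scope.
Local Open Scope ring_scope.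

(** The coordinates of two points of the simplex have the same sum, so their
differences [q_i - p_i] sum to zero. Hence they cannot all be negative, they
vanish as soon as none is positive, and an upper bound [d] on all of them
gives the lower bound [- N d]. The last fact makes a bound on [D P Q] alone,
or on [D Q P] alone, confine [Q] to a Euclidean neighbourhood of [P], since
[f] is strictly increasing; the continuity of [f] makes balls open. *)

(** Every open [U] is the union of the members of [B] contained in it. The criterion serves for the
    forward and the backward balls alike. *)
Lemma open_of_baseE (T : topologicalType) (B : set (set T)) :
  B `<=` open ->
  (forall x U, nbhs x U -> exists2 V, B V & V x /\ V `<=` U) ->
  open_of_base B = (@open T).
Proof.
move=> Bopen Bnbhs; apply/seteqP; split=> [U [C CB ->]|U Uopen].
  by apply: bigcup_open => V /CB /Bopen.
exists [set V | B V /\ V `<=` U]; first by move=> V [].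
apply/seteqP; split=> [x Ux|x [V [_ VU] /VU]//].
have [V BV [Vx VU]] := Bnbhs x U (open_nbhs_nbhs (conj Uopen Ux)).
by exists V.
Qed.

Section zero_sum.
Variables (R : realFieldType) (N : nat) (d : 'I_N.+1 -> R).
Hypothesis d0 : \sum_i d i = 0.

Lemma zero_sum_exists_ge0 : exists i, 0 <= d i.
Proof.
apply/not_existsP => dn; suff : \sum_i d i < 0 by rewrite d0 ltxx.
(* Isolating index 0 provides one strictly positive term [- d 0]; the others need only be
   nonnegative. *)
rewrite -subr_gt0 sub0r -sumrN big_ord_recl.
apply: ltr_pwDl; last apply: sumr_ge0 => i _.
  by rewrite oppr_gt0 ltNge; apply/negP/dn.
by rewrite oppr_ge0 ltW// ltNge; apply/negP/dn.
Qed.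

Lemma zero_sum_le0_eq0 : (forall i, d i <= 0) -> forall i, d i = 0.
Proof.
move=> dle i; apply/eqP; rewrite -oppr_eq0; apply/eqP.
have dN0 : \sum_i - d i = 0 by rewrite sumrN d0 oppr0.
by apply: (psumr_eq0P _ dN0) => // j _; rewrite oppr_ge0.
Qed.

Lemma zero_sum_norm_lt e : (forall i, d i < e) ->
  forall i, `|d i| < e *+ N.+1.
Proof.
move=> de i; have [j dj] := zero_sum_exists_ge0.
have e0 : 0 < e := le_lt_trans dj (de j).
rewrite ltr_norml; apply/andP; split; last first.
  by apply: lt_le_trans (de i) _; rewrite mulrS lerDl mulrn_wge0// ltW.
(* Only a weak bound, as the sum is empty when [N = 0]; the extra [e] in [e *+ N.+1] restores
   strictness. *)
have : \sum_(k | k != i) d k <= e *+ N.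
  have -> : e *+ N = \sum_(k < N.+1 | k != i) e.
    by rewrite sumr_const cardC1 card_ord.
  by apply: ler_sum => k _; exact: ltW.
move: d0; rewrite (bigD1 i)//= mulrS; lra.
Qed.

End zero_sum.
Arguments zero_sum_exists_ge0 {R N d}.
Arguments zero_sum_le0_eq0 {R N d}.
Arguments zero_sum_norm_lt {R N d}.

Section simplex.
Variables (R : realType) (N : nat).
Implicit Types P Q : prob_simplex R N.

Lemma simplex_coord_itv P i : \val P 0 i \in `[0, 1]%R.
Proof. by have /set_mem[/(_ i)] := valP P; rewrite in_itv. Qed.

Lemma simplex_sub_sum P Q : \sum_i (\val Q 0 i - \val P 0 i) = 0.
Proof.
have /set_mem[_ P1] := valP P; have /set_mem[_ Q1] := valP Q.
by rewrite sumrB P1 Q1 subrr.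
Qed.

Lemma simplex_coord_continuous i :
  continuous (fun P : prob_simplex R N => \val P 0 i).
Proof.
move=> P.
apply: (@continuous_comp _ _ _ set_val (fun M : 'rV[R]_N.+1 => M 0 i) P).
  exact: initial_continuous.
exact: coord_continuous.
Qed.

(** A neighbourhood contains the trace of an open set of row vectors, and balls of the max norm are
    described coordinate by coordinate. *)
Lemma nbhs_simplex P (U : set (prob_simplex R N)) : nbhs P U ->
  exists2 e : R, 0 < e &
    forall Q, (forall i, `|\val Q 0 i - \val P 0 i| < e) -> U Q.
Proof.
move=> [V [[A Aopen <-] AP] VU].
have /nbhs_ballP[e e0 eA] := open_nbhs_nbhs (conj Aopen AP).
exists e => // Q PQ; apply/VU/eA; split=> // i j.
by rewrite ord1 -ball_normE /= distrC; exact: PQ.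
Qed.

Section simplex_dist.
Variable f : R -> R.
Hypothesis f_incr : {in `[0, 1] &, {homo f : x y / x < y}}.

Local Notation D := (@simplex_dist R N f).

(** The default value of the maximum is its term of index 0, so the bound that [bigmax_ltP] asks of
    it is an instance of the bound on all terms. *)
Lemma simplex_dist_ltP P Q r :
  D P Q < r <-> forall i, f (\val Q 0 i) - f (\val P 0 i) < r.
Proof.
split=> [/bigmax_ltP[_ PQ] i|PQ]; first exact: PQ.
by apply/bigmax_ltP.
Qed.

Lemma simplex_dist_leP P Q r :
  D P Q <= r <-> forall i, f (\val Q 0 i) - f (\val P 0 i) <= r.
Proof.
split=> [/bigmax_leP[_ PQ] i|PQ]; first exact: PQ.
by apply/bigmax_leP.
Qed.

Lemma simplex_dist_ge P Q i : f (\val Q 0 i) - f (\val P 0 i) <= D P Q.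
Proof. by move: i; apply/simplex_dist_leP. Qed.

Lemma f_coord_le P Q i :
  (f (\val P 0 i) <= f (\val Q 0 i)) = (\val P 0 i <= \val Q 0 i).
Proof. by rewrite (le_mono_in f_incr) ?simplex_coord_itv. Qed.

Lemma simplex_distxx P : D P P = 0.
Proof.
apply/le_anti/andP; split; first by apply/simplex_dist_leP => i; rewrite subrr.
by rewrite -(subrr (f (\val P 0 ord0))) simplex_dist_ge.
Qed.

Lemma simplex_dist_quasimetric : is_quasimetric D.
Proof.
split=> [P Q|P Q|P Q S].
(* Some coordinate does not decrease from [P] to [Q]; its term in the maximum is nonnegative. *)
- have [i] := zero_sum_exists_ge0 (simplex_sub_sum P Q).
  rewrite subr_ge0 -f_coord_le -subr_ge0 => PQ.
  exact: le_trans PQ (simplex_dist_ge P Q i).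
- split=> [PQ|->]; last exact: simplex_distxx.
  apply/val_inj/rowP => i; apply/esym/eqP; rewrite -subr_eq0; apply/eqP.
  apply: (zero_sum_le0_eq0 (simplex_sub_sum P Q)) => {}i.
  by rewrite subr_le0 -f_coord_le -subr_le0 -PQ simplex_dist_ge.
- apply/simplex_dist_leP => i.
  have := lerD (simplex_dist_ge P Q i) (simplex_dist_ge Q S i); lra.
Qed.

(** Any [r] below [f (x + e) - f x] works if [x + e <= 1]; otherwise [y - x < e] holds for every [y]
    in the interval. Asking for all small [r], and not just one, lets the finitely many coordinates
    share a radius. *)
Lemma incr_lt_near x e : x \in `[0, 1]%R -> 0 < e ->
  \forall r \near 0^'+, forall y, y \in `[0, 1]%R ->
    f y - f x < r -> y - x < e.
Proof.
move=> x01 e0; have [xe|xe] := leP (x + e) 1; last first.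
  apply: nearW => r y; rewrite in_itv/= => /andP[_ y1] _; lra.
have xe01 : x + e \in `[0, 1]%R.
  by move: x01; rewrite !in_itv/=; lra.
have fxe : 0 < f (x + e) - f x by rewrite subr_gt0 f_incr// ltrDl.
near=> r => y y01 fyr; rewrite ltNge; apply/negP => xey.
have : f (x + e) <= f y by rewrite (le_mono_in f_incr)//; lra.
have : r < f (x + e) - f x by near: r; exact: nbhs_right_lt.
lra.
Unshelve. all: by end_near. Qed.

Lemma incr_gt_near x e : x \in `[0, 1]%R -> 0 < e ->
  \forall r \near 0^'+, forall y, y \in `[0, 1]%R ->
    f x - f y < r -> x - y < e.
Proof.
move=> x01 e0; have [xe|xe] := leP 0 (x - e); last first.
  apply: nearW => r y; rewrite in_itv/= => /andP[y0 _] _; lra.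
have xe01 : x - e \in `[0, 1]%R.
  by move: x01; rewrite !in_itv/=; lra.
have fxe : 0 < f x - f (x - e) by rewrite subr_gt0 f_incr//; lra.
near=> r => y y01 fyr; rewrite ltNge; apply/negP => xey.
have : f y <= f (x - e) by rewrite (le_mono_in f_incr)//; lra.
have : r < f x - f (x - e) by near: r; exact: nbhs_right_lt.
lra.
Unshelve. all: by end_near. Qed.

Lemma forward_ball_sub_nbhs P (U : set (prob_simplex R N)) : nbhs P U ->
  exists2 r, 0 < r & forward_ball D P r `<=` U.
Proof.
move=> /nbhs_simplex[e e0 eU].
(* Dividing by [N.+1] offsets the factor lost in [zero_sum_norm_lt]. *)
have eN0 : 0 < e / N.+1%:R by rewrite divr_gt0.
near (0 : R)^'+ => r; exists r => // Q /simplex_dist_ltP PQr; apply: eU => i.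
have -> : e = e / N.+1%:R *+ N.+1 by rewrite -[RHS]mulr_natr divfK// pnatr_eq0.
apply: (zero_sum_norm_lt (simplex_sub_sum P Q)) => {}i.
move: (PQr i); move: (simplex_coord_itv Q i); move: (\val Q 0 i).
(* The threshold on [r] depends on [P] and [i] but not on [Q], which is why the coordinate of [Q]
   has been generalized. *)
move: i; near: r; apply: filter_forall => i.
exact: incr_lt_near (simplex_coord_itv P i) eN0.
Unshelve. all: by end_near. Qed.

Lemma backward_ball_sub_nbhs P (U : set (prob_simplex R N)) : nbhs P U ->
  exists2 r, 0 < r & backward_ball D P r `<=` U.
Proof.
move=> /nbhs_simplex[e e0 eU].
have eN0 : 0 < e / N.+1%:R by rewrite divr_gt0.
near (0 : R)^'+ => r; exists r => // Q /simplex_dist_ltP QPr; apply: eU => i.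
have -> : e = e / N.+1%:R *+ N.+1 by rewrite -[RHS]mulr_natr divfK// pnatr_eq0.
(* A backward ball bounds the opposite differences from above, and these sum to zero as well. *)
rewrite distrC; apply: (zero_sum_norm_lt (simplex_sub_sum Q P)) => {}i.
move: (QPr i); move: (simplex_coord_itv Q i); move: (\val Q 0 i).
move: i; near: r; apply: filter_forall => i.
exact: incr_gt_near (simplex_coord_itv P i) eN0.
Unshelve. all: by end_near. Qed.

Hypothesis f_cont : {within `[0, 1], continuous f}.

Lemma f_coord_continuous i :
  continuous (fun P : prob_simplex R N => f (\val P 0 i)).
Proof.
move=> P; have /subspace_continuousP fP := f_cont.
(* Continuity of [f] is relative to the unit interval, so the coordinate must converge within it; it
   does, since it takes all its values there. *)
have coord_cvg : (fun Q : prob_simplex R N => \val Q 0 i) @ P -->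
    within `[0, 1] (nbhs (\val P 0 i)).
  move=> A /(simplex_coord_continuous i P); apply: (@filterS _ (nbhs P)) => Q; apply.
  exact: simplex_coord_itv.
exact: cvg_comp coord_cvg (fP _ (simplex_coord_itv P i)).
Qed.

(** The ball is cut out by finitely many strict inequalities between continuous functions. *)
Lemma forward_ball_open P r : open (forward_ball D P r).
Proof.
rewrite openE => Q /simplex_dist_ltP PQr.
suff : \forall S \near Q, forall i,
    f (\val (S : prob_simplex R N) 0 i) - f (\val P 0 i) < r.
  by apply: filterS => S /simplex_dist_ltP.
apply: (filter_forall (F := nbhs Q)) => i.
have : f (\val Q 0 i) < r + f (\val P 0 i) by rewrite -ltrBlDr.
move=> /(cvgr_lt _ (f_coord_continuous i Q)); apply: filterS => S.
by rewrite ltrBlDr.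
Qed.

Lemma backward_ball_open P r : open (backward_ball D P r).
Proof.
rewrite openE => Q /simplex_dist_ltP QPr.
suff : \forall S \near Q, forall i,
    f (\val P 0 i) - f (\val (S : prob_simplex R N) 0 i) < r.
  by apply: filterS => S /simplex_dist_ltP.
apply: (filter_forall (F := nbhs Q)) => i.
have : f (\val P 0 i) - r < f (\val Q 0 i) by rewrite ltrBlDr -ltrBlDl.
move=> /(cvgr_gt _ (f_coord_continuous i Q)); apply: filterS => S.
by rewrite ltrBlDr -ltrBlDl.
Qed.

Lemma forward_open_simplex_dist : forward_open D = (@open (prob_simplex R N)).
Proof.
apply: open_of_baseE => [_ [P [r _ ->]]|P U]; first exact: forward_ball_open.
move=> /forward_ball_sub_nbhs[r r0 PU]; exists (forward_ball D P r).
  by exists P, r.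
by split=> //; rewrite /forward_ball/= simplex_distxx.
Qed.

Lemma backward_open_simplex_dist : backward_open D = (@open (prob_simplex R N)).
Proof.
apply: open_of_baseE => [_ [P [r _ ->]]|P U]; first exact: backward_ball_open.
move=> /backward_ball_sub_nbhs[r r0 PU]; exists (backward_ball D P r).
  by exists P, r.
by split=> //; rewrite /backward_ball/= simplex_distxx.
Qed.

End simplex_dist.
End simplex.

Theorem proposition2p2 (R : realType) (N : nat) (hN : (1 <= N)%N) (f : R -> R)
    (f_cont : {within `[0, 1], continuous f})
    (f_incr : {in `[0, 1] &, {homo f : x y / x < y}}) :
  let D : prob_simplex R N -> prob_simplex R N -> R := simplex_dist f in
  [/\ is_quasimetric D,
      unitopological D,
      forward_open D = (@open (prob_simplex R N)) &
      backward_open D = (@open (prob_simplex R N))].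
Proof.
have fwd := forward_open_simplex_dist _ N _ f_incr f_cont.
have bwd := backward_open_simplex_dist _ N _ f_incr f_cont.
split=> //; first exact: simplex_dist_quasimetric.
by rewrite /unitopological fwd bwd.
Qed.
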